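(* Let $Y \in V^n$ be a tuple of samples, and let $G \subseteq \mathrm{GL}(V)$ be a group that is closed under non-zero scalar multiples. The stability of $Y$ under the action of $G_{\mathrm{SL}}^{\pm}$ on $V^n$ is related to maximum likelihood estimation for the Gaussian group model $\mathcal{M}_G$ as follows: (a) $Y$ is unstable if and only if $\ell_Y$ is not bounded from above on $\mathcal{M}_G$; (b) $Y$ is semistable if and only if $\ell_Y$ is bounded from above on $\mathcal{M}_G$; (c) if $Y$ is polystable, then an MLE given $Y$ exists.
   Context: $V$ is a finite-dimensional real vector space, identified with $\mathbb{R}^m$, $m=\dim V$, by a fixed isomorphism, so that elements of $\mathrm{GL}(V)$ are invertible real $m\times m$ matrices. $G\subseteq \mathrm{GL}(V)$ is a subgroup; it is closed under non-zero scalar multiples if $cg\in G$ for all $g \in G$, $c\in\mathbb{R}\setminus\{0\}$. $G_{\mathrm{SL}}^{\pm}$ is the subgroup of all matrices in $G$ with determinant $\pm1$. The Gaussian group model given by $G$ is the set of concentration matrices $\mathcal{M}_G=\{g^{\mathsf T}g \mid g\in G\}$. For $Y=(Y_1,\dots,Y_n)\in V^n$, the log-likelihood is $\ell_Y(\Psi)=\log\det(\Psi)-\mathrm{tr}(\Psi S_Y)$ for $\Psi\in\mathcal{M}_G$, where $S_Y=\frac1n\sum_{i=1}^n Y_iY_i^{\mathsf T}$. An MLE given $Y$ is a matrix in $\mathcal{M}_G$ at which $\ell_Y$ attains its maximum over $\mathcal{M}_G$. The group $G$ acts on $V^n$ by $g\cdot Y=(gY_1,\dots,gY_n)$. Stability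 notions for a group $H$ acting linearly on a real or complex vector space $W$ and $v\in W$ (closures in the Euclidean topology): $v$ is unstable if $0\in\overline{H\cdot v}$; semistable if $0\notin\overline{H\cdot v}$; polystable if $v\neq0$ and the orbit $H\cdot v$ is closed. *)

(* Defs.v *)
From HB Require Import structures.
From mathcomp Require Import all_boot all_order all_algebra.
From mathcomp Require Import all_classical all_reals all_analysis.

Set Implicit Arguments.
Unset Strict Implicit.
Unset Printing Implicit Defensive.

Import Order.TTheory GRing.Theory Num.Theory.
Import numFieldNormedType.Exports.

Local Open Scope classical_set_scope.
Local Open Scope ring_scope.

Section Stability.
Context {T : Type} {K : numFieldType} {W : normedModType K}.
Implicit Types (H : set T) (act : T -> W -> W) (v : W).

Definition act_orbit H act v : set W := [set act h v | h in H].

Definition unstable H act v : Prop := closure (act_orbit H act v) 0.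

Definition semistable H act v : Prop := ~ closure (act_orbit H act v) 0.

Definition polystable H act v : Prop :=
  v != 0 /\ closed (act_orbit H act v).

End Stability.

Section GaussianGroupModel.
Context {R : realType} {m : nat}.
Implicit Types (G : set 'M[R]_m) (Psi : 'M[R]_m).

(* MathComp only provides {'GL_n[R]} as a group for finite R, hence subgroups
   of GL(R^m) are represented by sets of matrices. *)
Definition subgroup_GL G : Prop :=
  [/\ (forall g, G g -> g \in unitmx),
      G 1%:M,
      (forall g h, G g -> G h -> G (g *m h)) &
      (forall g, G g -> G (invmx g))].

Definition scalar_closed G : Prop :=
  forall (c : R) g, c != 0 -> G g -> G (c *: g).

Definition SLpm G : set 'M[R]_m :=
  [set g | G g /\ (\det g = 1 \/ \det g = -1)].

Definition gaussian_model G : set 'M[R]_m := [set g^T *m g | g in G].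

Section Samples.
Context {n : nat}.

(* A tuple Y in (R^m)^n is the m x n matrix whose j-th column is Y_j, so that
   the topology on tuples is that of 'M[R]_(m, n). *)
Definition sample_act (g : 'M[R]_m) (Y : 'M[R]_(m, n)) : 'M[R]_(m, n) := g *m Y.

Lemma col_sample_act g Y j : col j (sample_act g Y) = g *m col j Y.
Proof.
apply/matrixP => i k; rewrite /sample_act !mxE.
by apply: eq_bigr => l _; rewrite mxE.
Qed.

Definition sample_cov (Y : 'M[R]_(m, n)) : 'M[R]_m :=
  n%:R^-1 *: \sum_(j < n) (col j Y *m (col j Y)^T).

Definition loglik (Y : 'M[R]_(m, n)) Psi : R :=
  ln (\det Psi) - \tr (Psi *m sample_cov Y).

Definition bounded_loglik G (Y : 'M[R]_(m, n)) : Prop :=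
  has_ubound [set loglik Y Psi | Psi in gaussian_model G].

Definition is_MLE G (Y : 'M[R]_(m, n)) Psi : Prop :=
  gaussian_model G Psi /\
  forall Psi', gaussian_model G Psi' -> loglik Y Psi' <= loglik Y Psi.

End Samples.
End GaussianGroupModel.

(* Main.v *)
(** Every [g] in [G] factors as [t h] with [t > 0] and [h] of determinant
    [1] or [-1].  With [x = t^2] and [c = tr (S_(h Y))] the log-likelihood at
    [g^T g] is [m ln x - x c], which for fixed [c > 0] is maximal at
    [x = m / c], with maximum [m ln (m / c) - m] decreasing in [c], and which
    is unbounded as [c] tends to [0] and [x = 1 / c].  As [c] is
    proportional to the squared Frobenius norm of [h Y], maximum likelihood
    estimation amounts to norm minimization along the orbit of [Y]. *)
Require Import Defs.
From HB Require Import structures.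
From mathcomp Require Import all_boot all_order all_algebra.
From mathcomp Require Import all_classical all_reals all_analysis.
From mathcomp Require Import ring lra.
Import Order.TTheory GRing.Theory Num.Theory.
Import numFieldNormedType.Exports.
Local Open Scope classical_set_scope.
Local Open Scope ring_scope.

(** The squared Frobenius norm. The topology on matrices comes from the maximum norm instead, so the
    lemmas below compare the two. *)
Definition frob2 {R : realType} {m n : nat} (Z : 'M[R]_(m, n)) : R :=
  \sum_i \sum_j Z i j ^+ 2.

Lemma frob2_ge0 {R : realType} {m n : nat} (Z : 'M[R]_(m, n)) : 0 <= frob2 Z.
Proof. by apply: sumr_ge0 => i _; apply: sumr_ge0 => j _; exact: sqr_ge0. Qed.

Lemma entry_sqr_le_frob2 {R : realType} {m n : nat} (Z : 'M[R]_(m, n)) i j :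
  Z i j ^+ 2 <= frob2 Z.
Proof.
rewrite /frob2 (bigD1 i) //= (bigD1 j) //= -addrA lerDl addr_ge0 //.
  by apply: sumr_ge0 => k _; exact: sqr_ge0.
by apply: sumr_ge0 => k _; apply: sumr_ge0 => l _; exact: sqr_ge0.
Qed.

Lemma mx_norm_sqr_le_frob2 {R : realType} {m n : nat} (Z : 'M[R]_(m, n)) :
  `|Z| ^+ 2 <= frob2 Z.
Proof.
have [->|Z0] := eqVneq `|Z| 0; first by rewrite expr0n frob2_ge0.
have [[i j] /= Zij] := mx_norm_neq0 Z0.
rewrite [`|Z|]Zij real_normK ?num_real //; exact: entry_sqr_le_frob2.
Qed.

Lemma frob2_eq0 {R : realType} {m n : nat} (Z : 'M[R]_(m, n)) :
  (frob2 Z == 0) = (Z == 0).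
Proof.
apply/idP/eqP => [/eqP Z0|->]; last first.
  by rewrite /frob2 big1 // => i _; rewrite big1 // => j _; rewrite mxE expr0n.
apply/matrixP => i j; rewrite mxE; apply/eqP; rewrite -sqrf_eq0 eq_le sqr_ge0.
by rewrite andbT -Z0 entry_sqr_le_frob2.
Qed.

Lemma frob2_continuous {R : realType} {m n : nat} :
  continuous (@frob2 R m n).
Proof.
apply: continuous_big => [|i _]; first exact: add_continuous.
apply: continuous_big => [|j _]; first exact: add_continuous.
move=> Z.
by apply: (@continuousM R 'M[R]_(m, n) (fun M => M i j) (fun M => M i j));
  exact: coord_continuous.
Qed.

Lemma vec_mx_continuous {R : realType} {m n : nat} :
  continuous (@vec_mx R m n).
Proof.
move=> v A /nbhs_ballP[e /= e0 eA]; apply/nbhs_ballP; exists e => //= w [_ vw].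
by apply: eA; split=> // i j; rewrite !mxE; exact: vw.
Qed.

(** Heine-Borel, applied to row vectors: [A] is the continuous image under [vec_mx] of its preimage,
    which is closed and bounded. *)
Lemma closed_frob2_bounded_compact {R : realType} {m n : nat}
    (A : set 'M[R]_(m, n)) (c : R) :
  closed A -> (forall Z, A Z -> frob2 Z <= c) -> compact A.
Proof.
move=> clA Ac.
have -> : A = vec_mx @` (vec_mx @^-1` A).
  rewrite eqEsubset; split=> [Z AZ|_ [v Av <-] //].
  by exists (mxvec Z); rewrite /= mxvecK.
apply: continuous_compact.
  by apply: continuous_subspaceT; exact: vec_mx_continuous.
apply: bounded_closed_compact; last first.
  by apply: preimage_closed => // v _; exact: vec_mx_continuous.
(* The hypothesis bounds the square of the norm; [c <= (1 + c) ^+ 2] for [0 <= c] spares a square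
   root. *)
exists (1 + c); split; first exact: num_real.
move=> M cM v /= Av; have vc := Ac _ Av.
have c0 := le_trans (frob2_ge0 _) vc.
have M0 : 0 <= M by lra.
have [->|v0] := eqVneq `|v| 0; first by [].
have [[i k] /= vik] := mx_norm_neq0 v0.
case/mxvec_indexP: k vik => j k vik.
rewrite [`|v|]vik -ler_sqr ?nnegrE // real_normK ?num_real //.
have := entry_sqr_le_frob2 (vec_mx v) j k; rewrite mxE (ord1 i) => h.
by rewrite (le_trans h) // (le_trans vc) //; nra.
Qed.

(** [frob2] is continuous and vanishes at [0], and conversely it dominates the square of the maximum
    norm, so its sublevel sets form a neighbourhood basis of [0]. *)
Lemma closure0_frob2P {R : realType} {m n : nat} (A : set 'M[R]_(m, n)) :
  closure A 0 <-> forall e, 0 < e -> exists2 Z, A Z & frob2 Z < e.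
Proof.
split=> [A0 e e0|Ae B /nbhs_ballP[e /= e0 eB]].
  have [|Z [AZ Ze]] := A0 [set Z | frob2 Z < e]; last by exists Z.
  apply: (@frob2_continuous R m n 0 [set x | x < e]); apply: lt_nbhsl.
  by have /eqP -> : frob2 (0 : 'M[R]_(m, n)) == 0 by rewrite frob2_eq0.
have [|Z AZ Ze] := Ae (e ^+ 2); first by rewrite exprn_gt0.
exists Z; split=> //; apply: eB.
rewrite mx_norm_ball /ball_ /= sub0r normrN.
rewrite -ltr_sqr ?nnegrE ?normr_ge0 ?(ltW e0) //.
exact: le_lt_trans (mx_norm_sqr_le_frob2 Z) Ze.
Qed.

(** [A] may be unbounded, but its part where [frob2] does not exceed the value at a chosen point is
    compact, and a minimum there is global. *)
Lemma closed_frob2_min {R : realType} {m n : nat} (A : set 'M[R]_(m, n)) :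
  A !=set0 -> closed A ->
  exists2 Z, A Z & forall Z', A Z' -> frob2 Z <= frob2 Z'.
Proof.
move=> [Z0 AZ0] clA; pose B := A `&` [set Z | frob2 Z <= frob2 Z0].
have clB : closed B.
  apply: closedI => //; apply: (@preimage_closed _ _ frob2 [set x | x <= _]).
    by move=> Z _; exact: frob2_continuous.
  exact: closed_le.
have cB : compact B.
  by apply: (closed_frob2_bounded_compact B (frob2 Z0) clB) => Z -[].
have B0 : B !=set0 by exists Z0; split=> //=.
have [|Z] := @compact_EVT_min _ R frob2 B B0 cB.
  by apply: continuous_subspaceT; exact: frob2_continuous.
rewrite inE => -[AZ /= ZZ0] Zmin; exists Z => // Z' AZ'.
have [Z'Z0|/ltW Z0Z'] := leP (frob2 Z') (frob2 Z0); last exact: le_trans Z0Z'.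
by apply: Zmin; rewrite inE.
Qed.

(** By cyclicity, the trace of [g^T *m g *m Y *m Y^T] is that of the Gram matrix of the rows of
    [g *m Y]. *)
Lemma tr_gram_sample_cov {R : realType} {m n : nat} (g : 'M[R]_m)
    (Y : 'M[R]_(m, n)) :
  \tr (g^T *m g *m sample_cov Y) = n%:R^-1 * frob2 (g *m Y).
Proof.
have -> : sample_cov Y = n%:R^-1 *: (Y *m Y^T).
  congr (_ *: _); apply/matrixP => i j; rewrite summxE !mxE.
  by apply: eq_bigr => k _; rewrite !mxE big_ord1 !mxE.
rewrite -scalemxAr mxtraceZ; congr (_ * _).
rewrite -mulmxA mxtrace_mulC -mulmxA -mulmxA mulmxA -trmx_mul.
apply: eq_bigr => i _; rewrite !mxE; apply: eq_bigr => j _.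
by rewrite [_^T _ _]mxE expr2.
Qed.

Lemma loglik_scale {R : realType} {m n : nat} (Y : 'M[R]_(m, n)) (h : 'M[R]_m)
    (t : R) : 0 < t -> \det h = 1 \/ \det h = -1 ->
  loglik Y ((t *: h)^T *m (t *: h)) =
  m%:R * ln (t ^+ 2) - t ^+ 2 * (n%:R^-1 * frob2 (h *m Y)).
Proof.
move=> t0 deth; rewrite /loglik tr_gram_sample_cov; congr (_ - _).
  rewrite det_mulmx det_tr detZ -expr2 exprMn.
  have -> : \det h ^+ 2 = 1 by case: deth => ->; rewrite ?sqrrN expr1n.
  by rewrite mulr1 exprAC (lnXn m) ?exprn_gt0 // mulr_natl.
rewrite mulrCA; congr (_ * _); rewrite /frob2 mulr_sumr; apply: eq_bigr => i _.
rewrite mulr_sumr; apply: eq_bigr => j _.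
by rewrite -scalemxAl mxE exprMn.
Qed.

Lemma SLpm_factor {R : realType} {m : nat} (G : set 'M[R]_m) (g : 'M[R]_m) :
  (0 < m)%N -> subgroup_GL G -> scalar_closed G -> G g ->
  exists t h, [/\ 0 < t, SLpm G h & g = t *: h].
Proof.
move=> m0 [Gunit _ _ _] Gscal Gg.
have det0 : \det g != 0 by have := Gunit _ Gg; rewrite unitmxE unitfE.
have ndet0 : 0 < `|\det g| by rewrite normr_gt0.
(* The [m]-th root of the absolute value of [\det g]; here [0 < m] matters. *)
pose t := expR (ln `|\det g| / m%:R).
have t0 : 0 < t by exact: expR_gt0.
have tm : t ^+ m = `|\det g|.
  rewrite /t -expRM_natl mulrC divfK ?lnK ?posrE //.
  by rewrite pnatr_eq0 -lt0n.
exists t, (t^-1 *: g); split=> //; last first.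
  by rewrite scalerA divff ?scale1r ?gt_eqF.
split; first by apply: Gscal => //; rewrite invr_eq0 gt_eqF.
rewrite detZ exprVn tm; have [d0|d0] := ltP 0 (\det g).
  by left; rewrite gtr0_norm // mulVf.
by right; rewrite ler0_norm // invrN mulNr mulVf.
Qed.

(** Substituting [x = (a / c) * y] reduces the bound to [ln y <= y - 1]. *)
Lemma ln_sub_linear_le {R : realType} (a c x : R) :
  0 < a -> 0 < c -> 0 < x -> a * ln x - x * c <= a * ln (a / c) - a.
Proof.
move=> a0 c0 x0.
have y0 : 0 < x * c / a by rewrite divr_gt0 // mulr_gt0.
have -> : ln x = ln (x * c / a) + ln (a / c).
  rewrite -lnM ?posrE ?y0 ?divr_gt0 //; congr ln; field.
  by rewrite !gt_eqF.
have xc : x * c = a * (x * c / a) by rewrite [RHS]mulrC divfK ?gt_eqF.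
have : ln (x * c / a) <= x * c / a - 1.
  by have := @le_ln1Dx R (x * c / a - 1); rewrite subrKC; apply; lra.
move=> /(ler_wpM2l (ltW a0)); rewrite mulrBr mulr1 -xc; lra.
Qed.

Theorem theorem3p6 (R : realType) (m n : nat) (m_gt0 : (0 < m)%N)
    (n_gt0 : (0 < n)%N) (Y : 'M[R]_(m, n)) (G : set 'M[R]_m)
    (groupG : subgroup_GL G) (scalarG : scalar_closed G) :
  [/\ unstable (SLpm G) sample_act Y <-> ~ bounded_loglik G Y,
      semistable (SLpm G) sample_act Y <-> bounded_loglik G Y &
      polystable (SLpm G) sample_act Y -> exists Psi, is_MLE G Y Psi].
Proof.
have mR : 0 < m%:R :> R by rewrite ltr0n.
have nV : 0 < n%:R^-1 :> R by rewrite invr_gt0 ltr0n.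
have nV1 : n%:R^-1 <= 1 :> R by rewrite invf_le1 ?ltr0n // ler1n.
(* A bound uniform in [t] and [h]: lowering [frob2 (h *m Y)] to [e] only raises the log-likelihood.
   It serves both boundedness and the MLE. *)
have loglik_le h (e : R) : 0 < e -> e <= frob2 (h *m Y) -> SLpm G h ->
    forall t, 0 < t -> loglik Y ((t *: h)^T *m (t *: h)) <=
      m%:R * ln (m%:R / (n%:R^-1 * e)) - m%:R.
  move=> e0 eh [_ deth] t t0; rewrite loglik_scale //.
  apply: le_trans (ln_sub_linear_le _ _ (t ^+ 2) mR (mulr_gt0 nV e0) _).
    by rewrite lerD2l lerN2 ler_pM2l ?exprn_gt0 // ler_pM2l.
  exact: exprn_gt0.
have unstableP : unstable (SLpm G) sample_act Y <-> ~ bounded_loglik G Y.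
  rewrite /unstable closure0_frob2P; split=> [Ye [B]|Ynb].
    (* With this [x] the logarithmic term is [B + 2], while an orbit point with [frob2] below [x^-1]
       costs at most [1], so the value exceeds [B]. *)
    move=> /ubP BY; pose x := expR ((B + 2) / m%:R).
    have x0 : 0 < x by exact: expR_gt0.
    have [|_ [h Gh <-] he] := Ye x^-1; first by rewrite invr_gt0.
    have [t t0 tx] : exists2 t, 0 < t & t ^+ 2 = x.
      by exists (Num.sqrt x); rewrite ?sqrtr_gt0 // sqr_sqrtr // ltW.
    have /BY : [set loglik Y Psi | Psi in gaussian_model G]
        (loglik Y ((t *: h)^T *m (t *: h))).
      exists ((t *: h)^T *m (t *: h)) => //; exists (t *: h) => //.
      by apply: scalarG; [rewrite gt_eqF | case: Gh].
    rewrite loglik_scale //; last by case: Gh.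
    have lnx : ln x = (B + 2) / m%:R by exact: expRK.
    rewrite tx lnx mulrC divfK ?gt_eqF //.
    rewrite leNgt => /negP; apply.
    have xh1 : x * frob2 (h *m Y) < 1.
      by rewrite -(mulfV (lt0r_neq0 x0)) ltr_pM2l.
    have xh0 : 0 <= x * frob2 (h *m Y) by rewrite mulr_ge0 ?frob2_ge0 ?ltW.
    have := ler_pM (ltW nV) xh0 nV1 (ltW xh1); rewrite mulr1 mulrCA; lra.
  (* If no orbit point has [frob2] below [e], then [loglik_le] bounds the log-likelihood on the
     whole model. *)
  move=> e e0; apply: contrapT => noZ; apply: Ynb.
  exists (m%:R * ln (m%:R / (n%:R^-1 * e)) - m%:R).
  apply/ubP => _ [_ [g Gg <-] <-].
  have [t [h [t0 Gh ->]]] := SLpm_factor _ _ m_gt0 groupG scalarG Gg.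
  apply: loglik_le => //; rewrite leNgt; apply/negP => he; apply: noZ.
  by exists (h *m Y) => //; exists h.
split=> //.
  rewrite /semistable -/(unstable (SLpm G) sample_act Y) unstableP.
  by split=> [/contrapT|Yb nYb].
move=> [Y0 clY].
(* A closed orbit contains a vector [h *m Y] of minimal norm; it yields the MLE after rescaling. *)
have [|_ [h Gh <-] hmin] := closed_frob2_min _ _ clY.
  exists (sample_act 1%:M Y), 1%:M => //; case: groupG => _ G1 _ _.
  by split=> //; left; rewrite det1.
rewrite /sample_act in hmin.
have hunit : h \in unitmx.
  by case: groupG => Gunit _ _ _; apply: Gunit; case: Gh.
(* [h] is invertible and [Y] is non-zero, so the minimal norm is positive and can be divided by. *)
have q0 : 0 < frob2 (h *m Y).
  rewrite lt_neqAle frob2_ge0 andbT eq_sym frob2_eq0; apply: contra_neq Y0.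
  by move=> hY; rewrite -[Y](mulKmx hunit) hY mulmx0.
pose x := m%:R / (n%:R^-1 * frob2 (h *m Y)).
have x0 : 0 < x by rewrite divr_gt0 ?mulr_gt0.
have t0 : 0 < Num.sqrt x by rewrite sqrtr_gt0.
exists ((Num.sqrt x *: h)^T *m (Num.sqrt x *: h)); split.
  exists (Num.sqrt x *: h) => //; apply: scalarG; first by rewrite gt_eqF.
  by case: Gh.
move=> _ [g Gg <-].
have [t [k [tgt0 Gk ->]]] := SLpm_factor _ _ m_gt0 groupG scalarG Gg.
rewrite [leRHS]loglik_scale //; last by case: Gh.
(* The linear term at [x] is exactly [m], so the candidate attains the bound of [loglik_le] with [e]
   the minimal value of [frob2] on the orbit. *)
rewrite sqr_sqrtr ?(ltW x0) // [x * _]divfK ?gt_eqF ?mulr_gt0 //.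
by apply: loglik_le => //; apply: hmin; exists k.
Qed.
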